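(* Assume appropriate regularity: the initial data $u_0$ considered are $2L$-periodic functions for which the solution $u$, $2L$-periodic in $x$, of $$\partial_t u+\partial_x\Big(\frac{u^2}{2}-\partial_x u+\mathcal{J}[u]\Big)=0,\qquad u(0,\cdot)=u_0,$$ is sufficiently smooth. Then for every such $u_0$ there exist positive constants $C_1=C_1(u_0)$, $C_2=C_2(u_0)$, independent of $\Delta t$ and $h$, such that, under the condition $$C_1\frac{\Delta t}{h^2}+C_2\frac{\Delta t}{h^{4/3}}\le 1,$$ the Crank–Nicolson Galerkin scheme is C-stable; that is: for every $T>0$ there is a constant $K(T)>0$, independent of $\Delta t$, of $h$ and of the initial data, such that, whenever $\Delta t$, $h$ and $u_0$ satisfy $C_1(u_0)\frac{\Delta t}{h^2}+C_2(u_0)\frac{\Delta t}{h^{4/3}}\le 1$, $U^0=u_h^0\in\mathcal{S}_h^r$ satisfies $\|u_h^0-u_0\|\le C_0h^{r-1}$, and $U^0,U^1,\dots,U^N\in\mathcal{S}_h^r$ satisfy $$(\partial U^n,\chi)+(U^{n+1/2}U_x^{n+1/2},\chi)+(U_x^{n+1/2},\chi')-(\mathcal{J}[U^{n+1/2}],\chi')=0\qquad\forall\chi\in\mathcal{S}_h^r,\ n=0,\dots,N-1,$$ one has $$\|U^n\|\le K(T)\,\|U^0\|\qquad\text{for all } 0\le n\le \frac{T}{\Delta t}.$$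
   Context: Fix $L>0$. All functions are real-valued. For real $s\ge 0$, $H^s_{per}$ is the Sobolev space of $2L$-periodic functions on $\mathbf{R}$ of order $s$, with norm $\|\cdot\|_s$ over one period; $\|\cdot\|$ and $(\cdot,\cdot)$ are the norm and inner product of $L^2(-L,L)$. Subscript $x$ and prime denote spatial derivatives. Nonlocal operator (with the integral truncated to $(0,L)$): $\mathcal{J}[\varphi](x)=\int_0^{L}|\xi|^{-1/3}\varphi'(x-\xi)\,d\xi$. Finite element spaces: $r\ge 2$ is an integer. For a partition $-L=x_0<x_1<\dots<x_M=L$ with $h=\max_j(x_{j+1}-x_j)$, $\mathcal{S}_h^r$ is a finite-dimensional subspace of $H^1_{per}$ consisting of continuously differentiable $2L$-periodic piecewise polynomial functions of degree $r-1$. The family $(\mathcal{S}_h^r)$ is assumed to satisfy, for small $h$, $\inf_{\chi\in\mathcal{S}_h^r}\{\|v-\chi\|+h\|(v-\chi)'\|\}\le C h^s\|v\|_s$ for all $v\in H^s_{per}$, $1\le s\le r$, with $C$ independent of $h$ and $v$. It is also assumed to satisfy the inverse inequality $\|\chi'\|\le C h^{-1}\|\chi\|$ for all $\chi\in\mathcal{S}_h^r$, with $C$ independent of $h$. Time grid: for $T>0$ and $N\in\mathbf{N}$, $\Delta t=T/N$, $\partial U^n=(U^{n+1}-U^n)/\Delta t$, $U^{n+1/2}=(U^n+U^{n+1})/2$. $C_0$ is a fixed constant independent of $h$. ''Sufficiently smooth'' means: of class $C^m$ in $(t,x)$ for some sufficiently large integer $m$ depending only on $r$. *)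

(* Defs.v *)
From HB Require Import structures.
From mathcomp Require Import all_boot all_order all_algebra.
From mathcomp Require Import all_classical all_reals all_analysis.

Set Implicit Arguments.
Unset Strict Implicit.
Unset Printing Implicit Defensive.

Import Order.TTheory GRing.Theory Num.Theory.
Import numFieldNormedType.Exports.

Local Open Scope ring_scope.
Local Open Scope classical_set_scope.

Section FunctionSpaces.
Context {R : realType}.
Implicit Types (L s : R) (f g v : R -> R).

Definition period L : set R := `]- L, L[.

Definition ip L f g : R :=
  \int[@lebesgue_measure R]_(x in period L) (f x * g x).

Definition l2norm L f : R := Num.sqrt (ip L f f).

(* Elements of L^2 are represented by everywhere periodic functions. *)
Definition L2per L f : Prop :=
  [/\ periodic f (2 * L), measurable_fun setT f &
      (@lebesgue_measure R).-integrable (period L)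
        (fun x => ((f x) ^+ 2)%:E)].

(* |c_k|^2 for c_k = (2L)^-1 \int_{-L}^{L} f(x) e^{-i k pi x / L} dx. *)
Definition fourier_sq L f (k : int) : R :=
  let w := k%:~R * pi / L in
  ((2 * L)^-1 * ip L f (fun x => cos (w * x))) ^+ 2 +
  ((2 * L)^-1 * ip L f (fun x => sin (w * x))) ^+ 2.

(* The factor 2L makes the norm of order 0 the L^2 norm over one period, and
   the norm of order 1 the square root of ||f||^2 + ||f'||^2. *)
Definition hnorm_sq L s f : \bar R :=
  ((2 * L)%:E *
   \esum_(k in [set: int])
     ((1 + (k%:~R * pi / L) ^+ 2) `^ s * fourier_sq L f k)%:E)%E.

Definition Hper L s f : Prop := L2per L f /\ (hnorm_sq L s f < +oo)%E.

Definition hnorm L s f : R := Num.sqrt (fine (hnorm_sq L s f)).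

Definition smooth_per L f : Prop :=
  periodic f (2 * L) /\ forall n x, derivable (derive1n n f) x 1.

Definition is_weak_deriv L f g : Prop :=
  L2per L g /\
  forall phi, smooth_per L phi -> ip L f (derive1 phi) = - ip L g phi.

(* The weak derivative, unique up to a null set; an arbitrary function when
   there is none, which does not happen on H^1. *)
Definition weak_deriv L f : R -> R := get [set g | is_weak_deriv L f g].

Definition cont_diff f : Prop :=
  (forall x, derivable f x 1) /\ continuous (derive1 f).

(* C^m up to the boundary on the half-plane t >= 0, variables (t, x): the
   partial derivatives of order <= m exist for t > 0 and extend continuously
   to t = 0. *)
Fixpoint Cm_halfplane (m : nat) (u : R * R -> R) : Prop :=
  {within [set p : R * R | 0 <= p.1], continuous u} /\
  if m is m'.+1 then
    exists ut ux : R * R -> R,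
      [/\ Cm_halfplane m' ut, Cm_halfplane m' ux &
          forall t x : R, 0 < t ->
            is_derive t 1 (fun s => u (s, x)) (ut (t, x)) /\
            is_derive x 1 (fun y => u (t, y)) (ux (t, x))]
  else True.

End FunctionSpaces.

Section Equation.
Context {R : realType}.
Implicit Types (L : R) (v : R -> R) (u : R * R -> R).

Definition nonlocal L v (x : R) : R :=
  \int[@lebesgue_measure R]_(xi in `]0, L[)
    (`|xi| `^ (- (1 / 3)) * derive1 v (x - xi)).

Definition flux L v (x : R) : R := v x ^+ 2 / 2 - derive1 v x + nonlocal L v x.

Definition is_solution L u (u0 : R -> R) : Prop :=
  [/\ forall t, 0 <= t -> periodic (fun x => u (t, x)) (2 * L),
      forall x, u (0, x) = u0 x &
      forall t x : R, 0 < t ->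
        [/\ derivable (fun s => u (s, x)) t 1,
            derivable (fun y => u (t, y)) x 1,
            derivable (flux L (fun y => u (t, y))) x 1 &
            derive1 (fun s => u (s, x)) t + derive1 (flux L (fun y => u (t, y))) x
              = 0]].

Definition regular_data L (m : nat) (u0 : R -> R) : Prop :=
  periodic u0 (2 * L) /\ exists u, Cm_halfplane m u /\ is_solution L u u0.

End Equation.

Section FiniteElements.
Context {R : realType}.
Implicit Types (L : R) (p : seq R) (S : set (R -> R)) (v : R -> R).

(* A partition -L = x_0 < ... < x_M = L is encoded, as in [itv_partition], by
   the list p = [:: x_1; ...; x_M]. *)
Definition node L p (j : nat) : R := nth L (- L :: p) j.

Definition mesh L p : R :=
  \big[Num.max/0]_(j < size p) (node L p j.+1 - node L p j).

(* A polynomial of degree at most r - 1 is one of size at most r. *)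
Definition piecewise_poly L (r : nat) p v : Prop :=
  forall j, (j < size p)%N ->
    exists q : {poly R}, (size q <= r)%N /\
      forall x, node L p j <= x <= node L p j.+1 -> v x = q.[x].

Definition linear_subspace S : Prop :=
  S (fun=> 0) /\
  forall (a : R) f g, S f -> S g -> S (fun x => a * f x + g x).

Definition finite_dim S : Prop :=
  exists (n : nat) (e : 'I_n -> R -> R), forall f, S f ->
    exists c : 'I_n -> R, forall x, f x = \sum_(i < n) c i * e i x.

Definition fe_space L (r : nat) p S : Prop :=
  [/\ itv_partition (- L) L p, linear_subspace S, finite_dim S,
      S `<=` [set v | Hper L 1 v] &
      S `<=` [set v | [/\ cont_diff v, periodic v (2 * L) & piecewise_poly L r p v]]].

Section Family.
(* The index type only labels the members of the family; the parameter h of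
   the member i is the mesh size of its partition. *)
Variables (L : R) (r : nat) (I : Type) (p : I -> seq R) (S : I -> set (R -> R)).

Definition approximation_property : Prop :=
  exists2 h0 : R, 0 < h0 & forall s : R, 1 <= s <= r%:R ->
    exists C : R, forall i, mesh L (p i) <= h0 -> forall v, Hper L s v ->
      inf [set l2norm L (v - chi) + mesh L (p i) * l2norm L (weak_deriv L (v - chi))
          | chi in S i]
      <= C * mesh L (p i) `^ s * hnorm L s v.

Definition inverse_inequality : Prop :=
  exists C : R, forall i chi, S i chi ->
    l2norm L (derive1 chi) <= C * (mesh L (p i))^-1 * l2norm L chi.

Definition fe_family : Prop :=
  [/\ forall i, fe_space L r (p i) (S i),
      approximation_property & inverse_inequality].
End Family.

Definition tquot (dt : R) (U : nat -> R -> R) (n : nat) (x : R) : R :=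
  (U n.+1 x - U n x) / dt.

Definition tmid (U : nat -> R -> R) (n : nat) (x : R) : R :=
  (U n x + U n.+1 x) / 2.

Definition cn_scheme L S (dt : R) (N : nat) (U : nat -> R -> R) : Prop :=
  (forall n, (n <= N)%N -> S (U n)) /\
  forall n, (n < N)%N -> forall chi, S chi ->
    let V := tmid U n in
    ip L (tquot dt U n) chi + ip L (fun x => V x * derive1 V x) chi
    + ip L (derive1 V) (derive1 chi) - ip L (nonlocal L V) (derive1 chi) = 0.

End FiniteElements.

(* Main.v *)
Require Import Defs.
From mathcomp Require Import all_boot all_order all_algebra.
From mathcomp Require Import all_classical all_reals all_analysis.
From mathcomp Require Import measurable_realfun ring lra.

(* Testing the scheme with the midpoint V = U^{n+1/2} kills the convection term,
   since V^2 V' is the derivative of a periodic function, and leaves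
     (|U^{n+1}|^2 - |U^n|^2) / (2 dt) + |V'|^2 = (J[V], V').
   The right-hand side is at most |V'|^2 + C |V|^2 with C = C(L).  Indeed, split
   J at xi = d.  The kernel xi^{-1/3} is square integrable near 0, so by
   Cauchy-Schwarz the part xi <= d is at most sqrt(6 d^{1/3}) |V'|, which is
   small with d; integrating by parts, the part xi >= d is at most c(d) sup|V|,
   and sup|V|^2 <= a |V'|^2 + (1/a + 1/(2L)) |V|^2 for every a > 0.
   Hence |U^{n+1}|^2 - |U^n|^2 <= C dt (|U^n|^2 + |U^{n+1}|^2).  As h <= 2L, the
   mesh condition with C1 = 8 C L^2 + 1 forces C dt <= 1/2, and a discrete
   Gronwall argument gives |U^n|^2 <= exp(4 C T) |U^0|^2. *)

Import Order.TTheory GRing.Theory Num.Theory.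
Import numFieldNormedType.Exports.

Local Open Scope ring_scope.
Local Open Scope classical_set_scope.

(** * Integral bounds without measurability of the integrand *)

Section NonmeasurableIntegrands.
Context {d} {T : measurableType d} {R : realType}.
Variable mu : {measure set T -> \bar R}.

(* The integral of a nonnegative function is a supremum over simple functions
   below it, hence monotone without measurability; this spares a proof that
   J[v] is measurable. *)
Lemma ge0_le_integral_nonmeasurable (D : set T) (f g : T -> \bar R) :
  (forall x, D x -> 0 <= f x)%E -> (forall x, D x -> f x <= g x)%E ->
  (\int[mu]_(x in D) f x <= \int[mu]_(x in D) g x)%E.
Proof.
move=> f0 fg.
rewrite !ge0_integralE//; last by move=> x Dx; apply: le_trans (fg x Dx); exact: f0.
apply: ereal_sup_le => _ [h hf <-]; exists h => // x.
apply: le_trans (hf x) _; rewrite /patch; case: ifPn => // xD.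
by apply: fg; rewrite inE in xD.
Qed.

(** The integral of [f] is by definition the difference of the integrals of its positive and
    negative parts, and each of these lies between 0 and the integral of [g]. It serves in
    particular for the product of [nonlocal L v] with [derive1 v]. *)
Lemma norm_Rintegral_le_nonmeasurable (D : set T) (f g : T -> R) :
  measurable D -> mu.-integrable D (EFin \o g) ->
  (forall x, D x -> `|f x| <= g x) ->
  `|\int[mu]_(x in D) f x| <= \int[mu]_(x in D) g x.
Proof.
move=> mD ig fg; have fing := integrable_fin_num mD ig.
have le_part (f' : T -> \bar R) : (forall x, 0 <= f' x)%E ->
    (forall x, D x -> f' x <= `|f x|%:E)%E ->
    exists2 y : R, (\int[mu]_(x in D) f' x = y%:E)%E &
      0 <= y <= \int[mu]_(x in D) g x.
  move=> f'0 f'f.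
  have ge0 : (0 <= \int[mu]_(x in D) f' x)%E by exact: integral_ge0.
  have leg : (\int[mu]_(x in D) f' x <= \int[mu]_(x in D) (g x)%:E)%E.
    apply: ge0_le_integral_nonmeasurable => // x Dx.
    by apply: le_trans (f'f x Dx) _; rewrite lee_fin fg.
  have fin' : (\int[mu]_(x in D) f' x)%E \is a fin_num.
    by rewrite ge0_fin_numE// (le_lt_trans leg)// ltey_eq fing.
  exists (fine (\int[mu]_(x in D) f' x)%E); first by rewrite fineK.
  by rewrite fine_ge0//= /Rintegral fine_le.
rewrite {1}/Rintegral integralE.
have [||y -> /andP[y0 yg]] := le_part ((EFin \o f) ^\+)%E.
- by move=> x; exact: funepos_ge0.
- by move=> x _; rewrite funeposE -EFin_max lee_fin ge_max normr_ge0 ler_norm.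
have [||z -> /andP[z0 zg]] := le_part ((EFin \o f) ^\-)%E.
- by move=> x; exact: funeneg_ge0.
- move=> x _; rewrite funenegE -EFin_max lee_fin ge_max normr_ge0.
  by rewrite -normrN ler_norm.
by rewrite /= ler_norml; apply/andP; split; lra.
Qed.

End NonmeasurableIntegrands.

(** * The Cauchy-Schwarz inequality for real integrals *)

Section CauchySchwarz.
Context {d} {T : measurableType d} {R : realType}.
Variables (mu : {measure set T -> \bar R}) (D : set T) (f g : T -> R).
Hypotheses (mD : measurable D) (mf : measurable_fun D f) (mg : measurable_fun D g).
Hypothesis if2 : mu.-integrable D (fun x => (f x ^+ 2)%:E).
Hypothesis ig2 : mu.-integrable D (fun x => (g x ^+ 2)%:E).

Lemma integrable_mul_of_sqr : mu.-integrable D (fun x => (f x * g x)%:E).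
Proof.
have ifg : mu.-integrable D (fun x => (f x ^+ 2 + g x ^+ 2)%:E).
  by under eq_fun do rewrite EFinD; exact: integrableD.
apply: le_integrable ifg => //; first exact/measurable_EFinP/measurable_funM.
move=> x _ /=; rewrite lee_fin [leRHS]ger0_norm ?addr_ge0 ?sqr_ge0//.
rewrite normrM -(real_normK (num_real (f x))) -(real_normK (num_real (g x))).
by have := sqr_ge0 (`|f x| - `|g x|); nra.
Qed.

(** The integral of [(t f - g)^2] is nonnegative for every real [t]; this is [young], and a good
    choice of [t] concludes. *)
Lemma Rintegral_cauchy_schwarz :
  (\int[mu]_(x in D) (f x * g x)) ^+ 2 <=
  \int[mu]_(x in D) (f x ^+ 2) * \int[mu]_(x in D) (g x ^+ 2).
Proof.
have ifg := integrable_mul_of_sqr.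
set A := \int[mu]_(x in D) (f x ^+ 2); set B := \int[mu]_(x in D) (g x ^+ 2).
set X := \int[mu]_(x in D) (f x * g x).
have A0 : 0 <= A by apply: Rintegral_ge0 => x _; exact: sqr_ge0.
have B0 : 0 <= B by apply: Rintegral_ge0 => x _; exact: sqr_ge0.
have young t : 2 * t * X <= t ^+ 2 * A + B.
  have iE1 : mu.-integrable D (EFin \o (fun x => t ^+ 2 * f x ^+ 2)).
    exact: (integrableZl mD (t ^+ 2) if2).
  have iE2 : mu.-integrable D (EFin \o (fun x => 2 * t * (f x * g x))).
    exact: (integrableZl mD (2 * t) ifg).
  rewrite /X /A /B -!RintegralZl// -RintegralD//; apply: le_Rintegral => //.
    exact: (integrableD mD iE1 ig2).
  by move=> x _; have := sqr_ge0 (t * f x - g x); nra.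
have [A_eq0|A_neq0] := eqVneq A 0; last first.
  have A_gt0 : 0 < A by rewrite lt_neqAle eq_sym A_neq0.
  (* This [t] minimizes the quadratic [t^2 A - 2 t X + B]. *)
  have := young (X / A).
  rewrite (_ : 2 * (X / A) * X = 2 * (X ^+ 2 / A)); last by ring.
  rewrite (_ : (X / A) ^+ 2 * A = X ^+ 2 / A); last by field.
  by move=> h; rewrite mulrC -ler_pdivrMr//; lra.
have [->|X_neq0] := eqVneq X 0; first by rewrite expr0n mulr_ge0.
(* With [A = 0] the bound is linear in [t], and this [t] turns it into the absurd [B + 1 <= B]. *)
have := young ((B + 1) / (2 * X)); rewrite A_eq0 mulr0 add0r.
rewrite (_ : 2 * ((B + 1) / (2 * X)) * X = B + 1); last by field.
by rewrite gerDl ler10.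
Qed.

End CauchySchwarz.

(** * Integrals of continuous functions and their primitives *)

Section Integrals.
Context {R : realType}.
Local Notation mu := (@lebesgue_measure R).
Implicit Types (f g F : R -> R) (a b x : R).

Lemma continuous_integrable_cc f a b :
  {within `[a, b], continuous f} -> mu.-integrable `[a, b] (EFin \o f).
Proof.
by move=> cf; apply: continuous_compact_integrable => //; exact: segment_compact.
Qed.

Lemma continuous_integrable_oo f a b :
  continuous f -> mu.-integrable `]a, b[ (EFin \o f).
Proof.
move=> cf; apply: (@integrableS _ _ _ mu `[a, b]) => //.
  exact: subset_itv_oo_cc.
exact/continuous_integrable_cc/continuous_subspaceT.
Qed.

Lemma Rintegral_oo_cc f a b : mu.-integrable `[a, b] (EFin \o f) ->
  \int[mu]_(x in `]a, b[) f x = \int[mu]_(x in `[a, b]) f x.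
Proof.
move=> fi.
rewrite Rintegral_itv_bndo_bndc ?Rintegral_itv_obnd_cbnd//.
- by apply: integrableS fi => //; apply: subset_itv; rewrite bnd_simp.
- by apply: integrableS fi => //; exact: subset_itv_oo_cc.
Qed.

Lemma Rintegral_oc_cc f a b : mu.-integrable `[a, b] (EFin \o f) ->
  \int[mu]_(x in `]a, b]) f x = \int[mu]_(x in `[a, b]) f x.
Proof.
move=> fi; rewrite Rintegral_itv_obnd_cbnd//.
by apply: integrableS fi => //; apply: subset_itv; rewrite bnd_simp.
Qed.

Lemma is_derive_continuous F x d : is_derive x 1 F d -> {for x, continuous F}.
Proof. by move=> [dF _]; apply/differentiable_continuous/derivable1_diffP. Qed.

Lemma Rintegral_FTC f F a b : a <= b -> {within `[a, b], continuous f} ->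
  (forall x, a <= x <= b -> is_derive x 1 F (f x)) ->
  \int[mu]_(x in `[a, b]) f x = F b - F a.
Proof.
rewrite le_eqVlt => /predU1P[->|ab] cf dF.
  by rewrite set_itv1 Rintegral_set1 subrr.
rewrite /Rintegral (@continuous_FTC2 _ f F)//.
- split.
  + move=> x; rewrite in_itv/= => /andP[/ltW ax /ltW xb].
    by have [] := dF x; rewrite ?ax.
  + apply: cvg_at_right_filter; apply: (@is_derive_continuous F a (f a)).
    by apply: dF; rewrite lexx ltW.
  + apply: cvg_at_left_filter; apply: (@is_derive_continuous F b (f b)).
    by apply: dF; rewrite lexx ltW.
- move=> x; rewrite in_itv/= => /andP[/ltW ax /ltW xb].
  by have := dF x; rewrite ax xb => /(_ isT) [_ <-]; rewrite derive1E.
Qed.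

(** Lets integrals over different subintervals be compared as increments of one function, which is
    monotone when the integrand is nonnegative. *)
Lemma exists_primitive f (M : R) : continuous f ->
  exists F, forall x, - M < x < M -> is_derive x 1 F (f x).
Proof.
move=> cf; exists (fun x => \int[mu]_(t in `[- M, x]) f t) => x /andP[Mx xM].
have [|dF eF] := @continuous_FTC1_closed R f (- M) x M xM _ Mx (cf x).
  exact/continuous_integrable_cc/continuous_subspaceT.
by split; [exact: dF|rewrite -derive1E; exact: eF].
Qed.

End Integrals.

(** * Square integrability of the kernel near the origin *)

Section Kernel.
Context {R : realType}.
Local Notation mu := (@lebesgue_measure R).
Implicit Types (b x : R).

Definition kern (x : R) : R := `|x| `^ (- (1 / 3)).

Lemma measurable_kern (D : set R) : measurable_fun D kern.
Proof.
apply: measurable_funTS; apply: (measurableT_comp (measurable_powR _)) => //.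
Qed.

(** The exponent -2/3 is written [1 / 3 - 1] to match the derivative of [3 x^(1/3)]. *)
Lemma sqr_kern x : 0 < x -> kern x ^+ 2 = x `^ (1 / 3 - 1).
Proof.
move=> x0; rewrite /kern gtr0_norm// -powR_mulrn ?powR_ge0// -powRrM.
by congr (_ `^ _); lra.
Qed.

Lemma is_derive_kern x : 0 < x ->
  is_derive x 1 kern (- (1 / 3) * x `^ (- (1 / 3) - 1)).
Proof.
move=> x0; apply: (near_eq_is_derive _ (is_derive1_powR (- (1 / 3)) x0)).
by near=> y; rewrite /kern gtr0_norm//; near: y; exact: lt_nbhsr.
Unshelve. all: by end_near. Qed.

Lemma continuous_powR_gt0 (p x : R) : 0 < x ->
  {for x, continuous (fun y => y `^ p)}.
Proof. by move=> x0; apply: is_derive_continuous; exact: is_derive1_powR. Qed.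

(** The integrand blows up at 0, so the interval is exhausted by the segments [[b / (n + 1), b]]. On
    each of them the primitive [3 x^(1/3)] gives the bound, which passes to the monotone limit. *)
Lemma integral_sqr_kern_le b : 0 < b ->
  (\int[mu]_(x in `]0%R, b]) (kern x ^+ 2)%:E <= (3 * b `^ (1 / 3))%:E)%E.
Proof.
move=> b0.
pose F n : set (measurableTypeR R) := `[b / n.+1%:R, b].
have mF n : measurable (F n) by exact: measurable_itv.
have a0 n : 0 < b / n.+1%:R by rewrite divr_gt0// ltr0n.
have Fpos n x : F n x -> 0 < x.
  by rewrite /F/= in_itv/= => /andP[+ _]; exact: lt_le_trans.
have -> : `]0, b] = \bigcup_n F n.
  apply/seteqP; split => [x|x [n _ Fx]]; last first.
    by move: (Fx); rewrite /F/= !in_itv/= (Fpos _ _ Fx) => /andP[].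
  rewrite /= in_itv/= => /andP[x0 xb].
  have xb0 : 0 < x / b by rewrite divr_gt0.
  (* Some [n] has [1 / (n + 1) < x / b], which places [x] in [F n]. *)
  have [n _ /(_ _ (leqnn n)) h] := near_infty_natSinv_lt (PosNum xb0).
  exists n => //; rewrite /F /= in_itv/= xb andbT.
  by move: h; rewrite /= ltr_pdivlMr// mulrC => /ltW.
have sqrk n : {in `[b / n.+1%:R, b]%classic,
    (fun x => x `^ (1 / 3 - 1)) =1 (fun x => kern x ^+ 2)}.
  by move=> x; rewrite inE => /Fpos x0; rewrite sqr_kern.
have cF n : {within `[b / n.+1%:R, b], continuous (fun x : R => x `^ (1 / 3 - 1))}.
  apply: continuous_in_subspaceT => x; rewrite inE => /Fpos x0.
  exact: continuous_powR_gt0.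
have intF n : (\int[mu]_(x in F n) (kern x ^+ 2)%:E <= (3 * b `^ (1 / 3))%:E)%E.
  rewrite -[leLHS]fineK; last first.
    apply: integrable_fin_num; first exact: mF.
    apply: (@eq_integrable _ _ _ mu (F n) (mF n)
      (EFin \o (fun x => x `^ (1 / 3 - 1)))) => //.
      by move=> x /sqrk /= ->.
    exact: (continuous_integrable_cc _ _ _ (cF n)).
  rewrite lee_fin -[leLHS]/(\int[mu]_(x in F n) (kern x ^+ 2)).
  have -> : \int[mu]_(x in F n) (kern x ^+ 2) =
      \int[mu]_(x in `[b / n.+1%:R, b]) (x `^ (1 / 3 - 1)).
    exact/esym/eq_Rintegral/sqrk.
  have dF x : b / n.+1%:R <= x <= b ->
      is_derive x 1 (fun x => 3 * x `^ (1 / 3)) (x `^ (1 / 3 - 1)).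
    move=> /andP[ax _]; have x0 : 0 < x by exact: lt_le_trans ax.
    have h := is_deriveZ 3 (is_derive1_powR (1 / 3) x0).
    by apply: (is_derive_eq h); rewrite /GRing.scale/=; field.
  rewrite (@Rintegral_FTC _ _ _ _ _ _ (cF n) dF).
    by rewrite gerBl mulr_ge0// powR_ge0.
  by rewrite ler_pdivrMr ?ltr0n// ler_peMr ?ler1n// ltW.
have cvgF : (\int[mu]_(x in F i) (kern x ^+ 2)%:E)%E @[i --> \oo] -->
    (\int[mu]_(x in \bigcup_i F i) (kern x ^+ 2)%:E)%E.
  apply: ge0_nondecreasing_set_cvg_integral => //.
  - move=> m n mn; apply/subsetPset/subset_itvr; rewrite bnd_simp.
    by rewrite ler_pM2l// lef_pV2 ?posrE// ler_nat.
  - move=> n; apply/measurable_EFinP.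
    by apply: measurable_funX; exact: measurable_kern.
  - by move=> n x _; rewrite lee_fin sqr_ge0.
rewrite -(cvg_lim _ cvgF)//; apply: lime_le.
  by apply/cvg_ex; eexists; exact: cvgF.
exact: nearW.
Qed.

Lemma integrable_sqr_kern b : 0 < b ->
  mu.-integrable `]0, b] (fun x => (kern x ^+ 2)%:E).
Proof.
move=> b0; apply/integrableP; split.
  by apply/measurable_EFinP/measurable_funX; exact: measurable_kern.
under eq_integral do rewrite gee0_abs ?lee_fin ?sqr_ge0//.
exact: le_lt_trans (integral_sqr_kern_le _ b0) (ltry _).
Qed.

Lemma Rintegral_sqr_kern_le b : 0 < b ->
  \int[mu]_(x in `]0, b]) (kern x ^+ 2) <= 3 * b `^ (1 / 3).
Proof.
move=> b0; rewrite -lee_fin fineK ?integral_sqr_kern_le//.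
by apply: integrable_fin_num => //; exact: integrable_sqr_kern.
Qed.

End Kernel.

(** * Reflections, translations and integrals over periodic windows *)

Section Shifts.
Context {R : realType}.
Local Notation mu := (@lebesgue_measure R).
Implicit Types (F g : R -> R) (a b c d x y : R).

Lemma is_derive_reflect F x y d : is_derive (x - y) 1 F d ->
  is_derive y 1 (fun y => F (x - y)) (- d).
Proof.
move=> dF; have h : is_derive y 1 (fun y => x - y) (-1).
  have h := is_deriveB (is_derive_cst x y 1) (is_derive_id y 1).
  by apply: (is_derive_eq h); rewrite sub0r.
by have := @is_derive1_comp R F (fun y => x - y) y _ _ dF h; rewrite mulrN1.
Qed.

Lemma is_derive_translate F c x d : is_derive (x + c) 1 F d ->
  is_derive x 1 (fun x => F (x + c)) d.
Proof.
move=> dF; have h : is_derive x 1 (fun x => x + c) 1.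
  have h := is_deriveD (is_derive_id x 1) (is_derive_cst c x 1).
  by apply: (is_derive_eq h); rewrite addr0.
by have := @is_derive1_comp R F (fun x => x + c) x _ _ dF h; rewrite mulr1.
Qed.

Lemma continuous_reflect g x : continuous g -> continuous (fun y => g (x - y)).
Proof.
move=> cg y; apply: (@continuous_comp _ _ _ (fun y => x - y) g); last exact: cg.
by apply: cvgB; [exact: cvg_cst|exact: cvg_id].
Qed.

Lemma continuous_sqr g : continuous g -> continuous (fun y => g y ^+ 2).
Proof. by move=> cg y; apply: cvgM; exact: cg. Qed.

(** The window [[x - d, x]] lies in [[-2L, L]], that is, one full period together with [[-2L, -L]].
    The latter is a translate of [[0, L]], so it contributes at most a second period integral. *)
Lemma Rintegral_reflect_le (L : R) g x d : 0 < L -> continuous g ->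
  periodic g (2 * L) -> (forall y, 0 <= g y) -> - L <= x <= L -> 0 <= d <= L ->
  \int[mu]_(y in `[0, d]) g (x - y) <= 2 * \int[mu]_(y in `[- L, L]) g y.
Proof.
move=> L0 cg pg g0 /andP[Lx xL] /andP[d0 dL].
(* The bound [4 * L] keeps all of [[-2L, L]] strictly inside the domain of the primitive. *)
have [Q dQ] := exists_primitive g (4 * L) cg.
have cgW a b : {within `[a, b], continuous g} by exact: continuous_subspaceT.
have intQ a b : - (4 * L) < a -> b < 4 * L -> a <= b ->
    \int[mu]_(y in `[a, b]) g y = Q b - Q a.
  move=> La bL ab; apply: Rintegral_FTC => // y /andP[ay yb].
  by apply: dQ; apply/andP; split; lra.
have leQ a b : - (4 * L) < a -> b < 4 * L -> a <= b -> Q a <= Q b.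
  by move=> La bL ab; rewrite -subr_ge0 -intQ//; apply: Rintegral_ge0.
have -> : \int[mu]_(y in `[0, d]) g (x - y) = - Q (x - d) - - Q (x - 0).
  apply: (Rintegral_FTC _ (fun y => - Q (x - y))) => //.
    exact/continuous_subspaceT/continuous_reflect.
  move=> y /andP[y0 yd]; rewrite -[g _]opprK; apply: is_deriveN.
  by apply: is_derive_reflect; apply: dQ; apply/andP; split; lra.
rewrite subr0 intQ; [|lra..].
(* By periodicity [Q (y + 2L)] is also a primitive of [g] on [[-2L, -L]]. *)
have : Q (- L) - Q (- (2 * L)) = Q L - Q 0.
  rewrite -intQ; [|lra..].
  have dQs y : - (2 * L) <= y <= - L ->
      is_derive y 1 (fun y => Q (y + 2 * L)) (g y).
    move=> /andP[ay yb]; rewrite -pg; apply: is_derive_translate; apply: dQ.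
    by apply/andP; split; lra.
  rewrite (Rintegral_FTC _ _ _ _ _ (cgW _ _) dQs); last by lra.
  by congr (Q _ - Q _); lra.
have : Q (- (2 * L)) <= Q (x - d) by apply: leQ; lra.
have : Q x <= Q L by apply: leQ; lra.
have : Q (- L) <= Q 0 by apply: leQ; lra.
lra.
Qed.

End Shifts.

(** * The nonlocal integral away from the singularity *)

Section FarField.
Context {R : realType}.
Local Notation mu := (@lebesgue_measure R).

(** On [[a, b]] the kernel is smooth, so integration by parts moves the derivative from [v] to the
    kernel. The constant is chosen before [v], hence depends only on the interval. *)
Lemma far_field_bound (a b : R) : 0 < a -> a <= b -> exists2 c : R, 0 <= c &
  forall (v : R -> R) (x M : R), cont_diff v ->
    (forall y, a <= y <= b -> `|v (x - y)| <= M) ->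
  `|\int[mu]_(y in `[a, b]) (kern y * derive1 v (x - y))| <= c * M.
Proof.
move=> a0 ab; pose k' (y : R) := - (1 / 3) * y `^ (- (1 / 3) - 1).
have ck'0 y : 0 < y -> {for y, continuous k'}.
  move=> y0; apply: cvgM; first exact: cvg_cst.
  exact: continuous_powR_gt0.
have within_gt0 (h : R -> R) : (forall y, 0 < y -> {for y, continuous h}) ->
    {within `[a, b], continuous h}.
  move=> ch; apply: continuous_in_subspaceT => y.
  rewrite inE/= in_itv/= => /andP[ay _]; apply: ch; exact: lt_le_trans ay.
have ck' := within_gt0 _ ck'0.
have ck : {within `[a, b], continuous kern}.
  by apply: within_gt0 => y /is_derive_kern /is_derive_continuous.
have mI : measurable (`[a, b] : set (measurableTypeR R)) by exact: measurable_itv.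
have ik' : mu.-integrable `[a, b] (EFin \o (fun y => `|k' y|)).
  apply/continuous_integrable_cc/within_gt0 => y y0.
  apply: (@continuous_comp _ _ _ k' Num.norm); first exact: ck'0.
  exact: norm_continuous.
(* Two boundary terms and the integral left by the integration by parts. *)
exists (`|kern a| + `|kern b| + \int[mu]_(y in `[a, b]) `|k' y|).
  by rewrite !addr_ge0//; apply: Rintegral_ge0.
move=> v x M [dv cw] vM.
have cv : continuous v.
  by move=> y; apply: is_derive_continuous (derive1 v y) _; split; rewrite ?derive1E.
have cvx : {within `[a, b], continuous (fun y => v (x - y))}.
  exact/continuous_subspaceT/continuous_reflect.
have cwx : {within `[a, b], continuous (fun y => derive1 v (x - y))}.
  exact/continuous_subspaceT/continuous_reflect.
have ckw : {within `[a, b], continuous (fun y => kern y * derive1 v (x - y))}.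
  by move=> y; apply: continuousM; [exact: ck|exact: cwx].
have ckv : {within `[a, b], continuous (fun y => k' y * v (x - y))}.
  by move=> y; apply: continuousM; [exact: ck'|exact: cvx].
have dkv y : a <= y <= b -> is_derive y 1 (fun y => - (kern y * v (x - y)))
    (kern y * derive1 v (x - y) - k' y * v (x - y)).
  move=> /andP[ay _]; have y0 : 0 < y by exact: lt_le_trans ay.
  have dvx : is_derive y 1 (fun y => v (x - y)) (- derive1 v (x - y)).
    by apply: is_derive_reflect; split; rewrite ?derive1E.
  have h := is_deriveN (is_deriveM (is_derive_kern _ y0) dvx).
  by apply: (is_derive_eq h); rewrite /GRing.scale/= /k'; ring.
have cd : {within `[a, b],
    continuous (fun y => kern y * derive1 v (x - y) - k' y * v (x - y))}.
  by move=> y; apply: cvgB; [exact: ckw|exact: ckv].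
have ikw := continuous_integrable_cc _ _ _ ckw.
have ikv := continuous_integrable_cc _ _ _ ckv.
have := Rintegral_FTC _ _ _ _ ab cd dkv.
rewrite (RintegralB mI ikw ikv) => /eqP; rewrite subr_eq => /eqP ->.
have bnd : `|\int[mu]_(y in `[a, b]) (k' y * v (x - y))| <=
    (\int[mu]_(y in `[a, b]) `|k' y|) * M.
  rewrite -RintegralZr//; apply: norm_Rintegral_le_nonmeasurable => //.
    exact: (integrableZr mI M ik').
  move=> y; rewrite /= in_itv/= => yab.
  by rewrite normrM ler_wpM2l// vM.
have va : `|kern a * v (x - a)| <= `|kern a| * M.
  by rewrite normrM ler_wpM2l// vM// lexx.
have vb : `|kern b * v (x - b)| <= `|kern b| * M.
  by rewrite normrM ler_wpM2l// vM// lexx ab.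
rewrite !mulrDl (le_trans (ler_normD _ _))// lerD//.
rewrite opprK (le_trans (ler_normD _ _))// normrN addrC lerD//.
Qed.

End FarField.

(** * Pointwise control of a continuously differentiable function *)

Section ContDiff.
Context {R : realType}.
Local Notation mu := (@lebesgue_measure R).
Implicit Types (v : R -> R) (L x : R).

Lemma cont_diff_is_derive v x : cont_diff v -> is_derive x 1 v (derive1 v x).
Proof. by move=> [dv _]; split; rewrite ?derive1E. Qed.

Lemma cont_diff_continuous v : cont_diff v -> continuous v.
Proof. by move=> cv x; exact: is_derive_continuous (cont_diff_is_derive v x cv). Qed.

Lemma periodic_derive1 v (T : R) :
  cont_diff v -> periodic v T -> periodic (derive1 v) T.
Proof.
move=> cdv pv x.
have vT : (fun y => v (y + T)) = v by apply: funext.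
have := is_derive_translate v T x _ (cont_diff_is_derive v _ cdv).
by rewrite vT => -[_ <-]; rewrite derive1E.
Qed.

(** For every [y], [v(x)^2] exceeds [v(y)^2] by at most the integral of [|2 v v'|], and Young's
    inequality with weight [a] bounds that integrand. Averaging over [y] yields the term with
    [(2 * L)^-1]. *)
Lemma sqr_le_mean v L a x : 0 < L -> 0 < a -> cont_diff v -> - L <= x <= L ->
  v x ^+ 2 <= a * \int[mu]_(y in `[- L, L]) (derive1 v y ^+ 2) +
    (a^-1 + (2 * L)^-1) * \int[mu]_(y in `[- L, L]) (v y ^+ 2).
Proof.
move=> L0 a0 cdv /andP[Lx xL]; have L20 : 0 < 2 * L by lra.
have cv := cont_diff_continuous v cdv.
have [_ cw] := cdv.
set w := derive1 v in cw *.
(* Young majorant of [|(v^2)'|]. *)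
pose g y := a * w y ^+ 2 + a^-1 * v y ^+ 2.
have mI b c : measurable (`[b, c] : set (measurableTypeR R)) by exact: measurable_itv.
have intc (f : R -> R) b c : continuous f -> mu.-integrable `[b, c] (EFin \o f).
  by move=> cf; apply: continuous_integrable_cc; exact: continuous_subspaceT.
have cw2 := continuous_sqr w cw.
have cv2 := continuous_sqr v cv.
have caw : continuous (fun y => a * w y ^+ 2).
  by move=> y; apply: cvgM; [exact: cvg_cst|exact: cw2].
have cav : continuous (fun y => a^-1 * v y ^+ 2).
  by move=> y; apply: cvgM; [exact: cvg_cst|exact: cv2].
have cg : continuous g by move=> y; apply: cvgD; [exact: caw|exact: cav].
have ig : \int[mu]_(y in `[- L, L]) g y =
    a * \int[mu]_(y in `[- L, L]) (w y ^+ 2) +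
    a^-1 * \int[mu]_(y in `[- L, L]) (v y ^+ 2).
  rewrite (RintegralD (mI _ _) (intc _ _ _ caw) (intc _ _ _ cav)).
  by rewrite (RintegralZl _ (mI _ _) (intc _ _ _ cw2))
    (RintegralZl _ (mI _ _) (intc _ _ _ cv2)).
have [Q dQ] := exists_primitive g (2 * L) cg.
have intQ b c : - L <= b -> c <= L -> b <= c ->
    \int[mu]_(y in `[b, c]) g y = Q c - Q b.
  move=> Lb cL bc; apply: Rintegral_FTC => //; first exact: continuous_subspaceT.
  by move=> y /andP[yb yc]; apply: dQ; apply/andP; split; lra.
have g0 y : 0 <= g y by rewrite addr_ge0// mulr_ge0// ?sqr_ge0// ?invr_ge0 ltW.
have leQ b c : - L <= b -> c <= L -> b <= c -> Q b <= Q c.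
  by move=> Lb cL bc; rewrite -subr_ge0 -intQ//; apply: Rintegral_ge0.
have osc b c : - L <= b -> c <= L -> b <= c ->
    `|v c ^+ 2 - v b ^+ 2| <= Q L - Q (- L).
  move=> Lb cL bc; apply: (@le_trans _ _ (Q c - Q b)); last first.
    by rewrite lerB// leQ// (le_trans Lb, le_trans bc).
  have cvw : continuous (fun y => 2 * v y * w y).
    move=> y; apply: cvgM; last exact: cw.
    by apply: cvgM; [exact: cvg_cst|exact: cv].
  have dv2 y : b <= y <= c -> is_derive y 1 (fun y => v y ^+ 2) (2 * v y * w y).
    move=> _; have h := is_deriveX 2 (cont_diff_is_derive v y cdv).
    by apply: (is_derive_eq h).
  rewrite -intQ// -(Rintegral_FTC _ _ _ _ bc (continuous_subspaceT cvw) dv2).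
  apply: norm_Rintegral_le_nonmeasurable => //; first exact: intc.
  (* Weights [sqrt a] and [sqrt a^-1], of product 1, reduce the bound to [|2 p q| <= p^2 + q^2]. *)
  have ea : a * a^-1 = 1 by rewrite divff ?gt_eqF.
  have ra : Num.sqrt a * Num.sqrt a^-1 = 1.
    by rewrite -sqrtrM ?ltW// ea sqrtr1.
  have sa : Num.sqrt a ^+ 2 = a by rewrite sqr_sqrtr// ltW.
  have sb : Num.sqrt a^-1 ^+ 2 = a^-1 by rewrite sqr_sqrtr// invr_ge0 ltW.
  move=> y _; set p := Num.sqrt a * w y; set q := Num.sqrt a^-1 * v y.
  have -> : g y = p ^+ 2 + q ^+ 2 by rewrite /g /p /q !exprMn sa sb.
  have -> : 2 * v y * w y = 2 * p * q.
    by transitivity (2 * (Num.sqrt a * Num.sqrt a^-1) * v y * w y);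
      [rewrite ra mulr1|rewrite /p /q; ring].
  rewrite ler_norml; apply/andP; split.
    by have := sqr_ge0 (p + q); nra.
  by have := sqr_ge0 (p - q); nra.
have vx y : - L <= y <= L -> v x ^+ 2 <= v y ^+ 2 + (Q L - Q (- L)).
  move=> /andP[Ly yL]; rewrite -lerBlDl (le_trans (ler_norm _))//.
  by have [xy|/ltW yx] := leP x y; [rewrite distrC|]; apply: osc.
have ccst (e : R) : continuous (fun _ : R => e) by move=> ?; exact: cvg_cst.
have cvc : continuous (fun y => v y ^+ 2 + (Q L - Q (- L))).
  by move=> y; apply: cvgD; [exact: cv2|exact: cvg_cst].
have mL : fine (mu `[- L, L]) = 2 * L.
  by rewrite lebesgue_measure_itv/= lte_fin ifT; [rewrite /=; lra|lra].
(* Integrate [vx] over [y] in a period of length [2 * L]. *)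
have h : v x ^+ 2 * (2 * L) <= \int[mu]_(y in `[- L, L]) (v y ^+ 2) +
     (Q L - Q (- L)) * (2 * L).
  rewrite -mL -!(Rintegral_cst mu (mI _ _)).
  rewrite -(RintegralD (mI _ _) (intc _ _ _ cv2) (intc _ _ _ (ccst _))).
  apply: (le_Rintegral (mI _ _) (intc _ _ _ (ccst _)) (intc _ _ _ cvc)).
  by move=> y; rewrite /= in_itv/=; exact: vx.
have LL : - L <= L by rewrite ge0_cp// ltW.
rewrite -(ler_pM2r L20) (le_trans h)// -intQ// ig.
rewrite le_eqVlt; apply/orP; left; apply/eqP; field.
by rewrite !gt_eqF.
Qed.

End ContDiff.

(** * Absorbing the nonlocal term into the dissipation *)

Section NonlocalBound.
Context {R : realType}.
Local Notation mu := (@lebesgue_measure R).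

(** After [(near + fr)^2 <= 2 near^2 + 2 fr^2], each part may spend [e / 2] on the integral of
    [v'^2]: the near part through the choice of [d], the far part through the choice of [a]. *)
Lemma nonlocal_sqr_le (L e : R) : 0 < L -> 0 < e -> exists2 C : R, 0 <= C &
  forall (v : R -> R) x, cont_diff v -> periodic v (2 * L) -> - L <= x <= L ->
    nonlocal L v x ^+ 2 <= e * \int[mu]_(y in `[- L, L]) (derive1 v y ^+ 2) +
      C * \int[mu]_(y in `[- L, L]) (v y ^+ 2).
Proof.
move=> L0 e0.
have [d /andP[d0 dL] de] : exists2 d : R, 0 < d <= L & 3 * d `^ (1 / 3) <= e / 8.
  (* The target [e / 8] is multiplied by 2 in [Rintegral_reflect_le] and by 2 again when the sum is
     squared, giving [e / 2]. *)
  exists (Num.min L ((e / 24) `^ 3)).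
    by rewrite lt_min L0 powR_gt0 ?divr_gt0//= ge_min lexx.
  have : (Num.min L ((e / 24) `^ 3)) `^ (1 / 3) <= ((e / 24) `^ 3) `^ (1 / 3).
    apply: ge0_ler_powR; rewrite ?nnegrE ?powR_ge0//.
      by rewrite le_min powR_ge0 ltW.
    by rewrite ge_min lexx orbT.
  rewrite -powRrM (_ : 3 * (1 / 3) = 1 :> R); last by field.
  by rewrite powRr1; [lra|rewrite divr_ge0// ltW].
have [c c0 far] := far_field_bound d L d0 dL.
(* Ensures [2 c^2 a <= e / 2]; the [+ 1] avoids a division by zero when [c = 0]. *)
pose a := e / (4 * (c ^+ 2 + 1)).
have c20 : 0 <= c ^+ 2 by exact: sqr_ge0.
have a0 : 0 < a by rewrite divr_gt0//; lra.
have ca : 2 * (c ^+ 2 * a) <= e / 2.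
  rewrite /a mulrA mulrA ler_pdivrMr; last by lra.
  by nra.
exists (2 * c ^+ 2 * (a^-1 + (2 * L)^-1)).
  by rewrite !mulr_ge0// addr_ge0// invr_ge0//; lra.
move=> v x cdv pv /andP[Lx xL].
have cv := cont_diff_continuous v cdv.
have [_ cw] := cdv.
have pw := periodic_derive1 v _ cdv pv.
set w := derive1 v in cw pw *.
set D := \int[mu]_(y in `[- L, L]) (w y ^+ 2).
set E := \int[mu]_(y in `[- L, L]) (v y ^+ 2).
have D0 : 0 <= D by apply: Rintegral_ge0 => y _; exact: sqr_ge0.
have E0 : 0 <= E by apply: Rintegral_ge0 => y _; exact: sqr_ge0.
pose S := a * D + (a^-1 + (2 * L)^-1) * E.
have S0 : 0 <= S.
  by rewrite addr_ge0// mulr_ge0// ?addr_ge0// ?invr_ge0; lra.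
(* The argument [x - y] of the far part ranges in [[-2L, L]]; points below [-L] are shifted by one
   period. *)
have vS y : - (2 * L) <= y <= L -> `|v y| <= Num.sqrt S.
  move=> /andP[Ly yL].
  rewrite -(ler_pXn2r (ltn0Sn 1)) ?nnegrE ?sqrtr_ge0// sqr_sqrtr//.
  rewrite real_normK ?num_real//.
  have [yL'|yL'] := leP (- L) y; first by apply: sqr_le_mean => //; rewrite yL' yL.
  by rewrite -pv; apply: sqr_le_mean => //; apply/andP; split; lra.
have cwx := continuous_reflect w x cw.
have mI (i : interval R) : measurable ([set` i] : set (measurableTypeR R)).
  exact: measurable_itv.
have iw2 (b : R) : mu.-integrable `]0, b] (fun y => (w (x - y) ^+ 2)%:E).
  apply: (@integrableS _ _ _ mu `[0, b]); [exact: mI|exact: mI| |].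
    by apply: subset_itv; rewrite bnd_simp.
  by apply: continuous_integrable_cc; apply: continuous_subspaceT; exact: continuous_sqr.
have mw (B : set (measurableTypeR R)) : measurable_fun B (fun y => w (x - y)).
  by apply: measurable_funTS; exact: continuous_measurable_fun.
have ikw (b : R) : 0 < b ->
    mu.-integrable `]0, b] (fun y => (kern y * w (x - y))%:E).
  move=> b0; apply: integrable_mul_of_sqr => //; first exact: measurable_kern.
  exact: integrable_sqr_kern.
pose near := \int[mu]_(y in `]0, d]) (kern y * w (x - y)).
pose fr := \int[mu]_(y in `[d, L]) (kern y * w (x - y)).
(* Endpoints are null sets; integrability of the product on []0, L]], from [ikw], permits the
   splitting at [d]. *)
have -> : nonlocal L v x = near + fr.
  have ikwL := ikw L L0.
  have sub : (`]d, L] `<=` `]0, L])%classic.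
    by apply: subset_itvr; rewrite bnd_simp ltW.
  rewrite /nonlocal Rintegral_itv_bndo_bndc; last first.
    apply: (integrableS (mI _) (mI _) _ ikwL).
    by apply: subset_itvl; rewrite bnd_simp.
  have /= := @Rintegral_itvB _ (fun y => kern y * w (x - y))
    (BRight 0) (BRight L) d ikwL.
  rewrite !bnd_simp => /(_ (ltW d0) dL).
  rewrite (@Rintegral_itv_obnd_cbnd _ d); last first.
    exact: (integrableS (mI _) (mI _) sub ikwL).
  by move=> e1; rewrite /fr -e1 addrC subrK.
have near_le : near ^+ 2 <= (e / 8) * (2 * D).
  have cs : near ^+ 2 <= (\int[mu]_(y in `]0, d]) (kern y ^+ 2)) *
      \int[mu]_(y in `]0, d]) (w (x - y) ^+ 2).
    exact: (Rintegral_cauchy_schwarz mu _ kern (fun y => w (x - y))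
      (mI _) (measurable_kern _) (mw _) (integrable_sqr_kern _ d0) (iw2 d)).
  apply: (le_trans cs); apply: ler_pM.
  - by apply: Rintegral_ge0 => y _; exact: sqr_ge0.
  - by apply: Rintegral_ge0 => y _; exact: sqr_ge0.
  - by apply: le_trans de; exact: Rintegral_sqr_kern_le.
  have icc : mu.-integrable `[0, d] (EFin \o (fun y => w (x - y) ^+ 2)).
    apply: continuous_integrable_cc; apply: continuous_subspaceT.
    exact: continuous_sqr.
  rewrite (Rintegral_oc_cc _ _ _ icc).
  apply: (Rintegral_reflect_le L (fun y => w y ^+ 2)) => //.
  - exact: continuous_sqr.
  - by move=> y; rewrite pw.
  - by move=> y; exact: sqr_ge0.
  - by rewrite Lx.
  - by rewrite ltW.
have far_le : fr ^+ 2 <= c ^+ 2 * S.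
  rewrite -(sqr_sqrtr S0) -exprMn -(real_normK (num_real fr)).
  rewrite ler_pXn2r ?nnegrE ?mulr_ge0 ?sqrtr_ge0//.
  apply: far => // y /andP[dy yL]; apply: vS; apply/andP; split; lra.
have : (near + fr) ^+ 2 <= 2 * near ^+ 2 + 2 * fr ^+ 2.
  by have := sqr_ge0 (near - fr); nra.
have : 2 * (c ^+ 2 * a) * D <= e / 2 * D by rewrite ler_wpM2r.
rewrite /S in far_le; move: far_le near_le; set k := a^-1 + _.
lra.
Qed.

(** Pointwise, [J v'] is at most [J^2 / 2 + v'^2 / 2]. With [e = (2 * L)^-1] the pointwise bound on
    [J^2], integrated over length [2 * L], costs exactly another half of the integral of [v'^2], so
    its total coefficient is 1. *)
Lemma ip_nonlocal_le (L : R) : 0 < L -> exists2 C : R, 0 <= C &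
  forall v : R -> R, cont_diff v -> periodic v (2 * L) ->
    ip L (nonlocal L v) (derive1 v) <=
      ip L (derive1 v) (derive1 v) + C * ip L v v.
Proof.
move=> L0.
have e0 : 0 < (2 * L)^-1 by rewrite invr_gt0; lra.
have [C C0 hC] := nonlocal_sqr_le L _ L0 e0.
exists (C * L); first by rewrite mulr_ge0// ltW.
move=> v cdv pv.
have cv := cont_diff_continuous v cdv.
have [_ cw] := cdv.
have int_oo (f : R -> R) : continuous f ->
    \int[mu]_(y in `]- L, L[) f y = \int[mu]_(y in `[- L, L]) f y.
  by move=> cf; apply/Rintegral_oo_cc/continuous_integrable_cc/continuous_subspaceT.
have ipE (f : R -> R) : continuous f ->
    ip L f f = \int[mu]_(y in `[- L, L]) (f y ^+ 2).
  move=> cf; rewrite -int_oo; last exact: continuous_sqr.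
  by apply: eq_Rintegral => y _; rewrite expr2.
rewrite !ipE//.
set D := \int[mu]_(y in `[- L, L]) (derive1 v y ^+ 2).
set E := \int[mu]_(y in `[- L, L]) (v y ^+ 2).
have mI : measurable (`]- L, L[ : set (measurableTypeR R)) by exact: measurable_itv.
pose B := (2 * L)^-1 * D + C * E.
have icst : mu.-integrable `]- L, L[ (EFin \o (fun _ : R => B / 2)).
  by apply: continuous_integrable_oo => ?; exact: cvg_cst.
have cw2 : continuous (fun y => 2^-1 * derive1 v y ^+ 2).
  by move=> y; apply: cvgM; [exact: cvg_cst|exact: continuous_sqr].
have iw2 := continuous_integrable_oo _ (- L) L cw2.
have : `|ip L (nonlocal L v) (derive1 v)| <=
    \int[mu]_(y in `]- L, L[) (B / 2 + 2^-1 * derive1 v y ^+ 2).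
  apply: (norm_Rintegral_le_nonmeasurable mu _ _ _ mI (integrableD mI icst iw2)).
  move=> x; rewrite /= in_itv/= => /andP[/ltW Lx /ltW xL].
  have := hC v x cdv pv; rewrite Lx xL => /(_ isT); rewrite -/D -/E -/B.
  set j := nonlocal L v x; set w := derive1 v x => hj.
  rewrite ler_norml; apply/andP; split.
    by have := sqr_ge0 (j + w); nra.
  by have := sqr_ge0 (j - w); nra.
have iw := continuous_integrable_oo _ (- L) L (continuous_sqr _ cw).
rewrite (RintegralD mI icst iw2) (RintegralZl _ mI iw).
rewrite (int_oo _ (continuous_sqr _ cw)).
have -> : \int[mu]_(x in `]- L, L[) (B / 2) = D / 2 + C * L * E.
  transitivity (B / 2 * fine (mu `]- L, L[)); first exact: Rintegral_cst.
  rewrite lebesgue_measure_itv/= lte_fin ifT; last by lra.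
  by rewrite /= /B; field; lra.
rewrite -/D.
move=> h; have := ler_norm (ip L (nonlocal L v) (derive1 v)); lra.
Qed.

End NonlocalBound.

(** * Discrete energy inequality and Gronwall argument *)

Section Energy.
Context {R : realType}.
Local Notation mu := (@lebesgue_measure R).

(** The upper bound turns the mesh condition, relative to [h], into an absolute bound on the time
    step. *)
Lemma mesh_gt0_le (L : R) (p : seq R) : 0 < L -> itv_partition (- L) L p ->
  0 < mesh L p <= 2 * L.
Proof.
move=> L0 pL; apply/andP; split.
(* An empty list would force [-L = L]. *)
- case: p pL => [/itv_partition_nil|x t pL]; first by move=> ?; lra.
  apply: (@lt_le_trans _ _ (node L (x :: t) 1 - node L (x :: t) 0)).
    by case: pL => /= /andP[Lx _] _; rewrite /node/= subr_gt0.
  exact: (le_bigmax _ (fun j : 'I_(size (x :: t)) =>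
    node L (x :: t) j.+1 - node L (x :: t) j) ord0).
- apply: bigmax_le => [|j _]; first by lra.
  have h1 : - L <= node L p j.
    by apply: itv_partition_nth_ge pL; rewrite ltnS ltnW.
  have h2 : node L p j.+1 <= L by apply: itv_partition_nth_le pL; rewrite ltnS.
  by lra.
Qed.

Lemma ip_mul_deriv_eq0 (L : R) (v : R -> R) : 0 < L -> cont_diff v ->
  periodic v (2 * L) -> ip L (fun x => v x * derive1 v x) v = 0.
Proof.
move=> L0 cdv pv; have cv := cont_diff_continuous v cdv; have [_ cw] := cdv.
have cf : continuous (fun x => v x * derive1 v x * v x).
  by move=> x; apply: cvgM; [apply: cvgM; [exact: cv|exact: cw]|exact: cv].
have dF x : - L <= x <= L ->
    is_derive x 1 (fun x => 3^-1 * v x ^+ 3) (v x * derive1 v x * v x).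
  move=> _; have h := is_deriveZ 3^-1 (is_deriveX 3 (cont_diff_is_derive v x cdv)).
  by apply: (is_derive_eq h); rewrite /GRing.scale/=; field.
have LL : - L <= L by lra.
rewrite /ip Rintegral_oo_cc; last first.
  by apply: continuous_integrable_cc; exact: continuous_subspaceT.
rewrite (Rintegral_FTC _ _ _ _ LL (continuous_subspaceT cf) dF).
have -> : v L = v (- L) by rewrite -(pv (- L)); congr v; lra.
by rewrite subrr.
Qed.

Lemma crank_nicolson_energy (L C dt : R) (S : set (R -> R)) N (U : nat -> R -> R) :
  0 < L -> 0 < dt -> 0 <= C ->
  (forall v, cont_diff v -> periodic v (2 * L) ->
    ip L (nonlocal L v) (derive1 v) <=
      ip L (derive1 v) (derive1 v) + C * ip L v v) ->
  linear_subspace S -> (forall v, S v -> cont_diff v /\ periodic v (2 * L)) ->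
  cn_scheme L S dt N U -> forall n, (n < N)%N ->
  ip L (U n.+1) (U n.+1) - ip L (U n) (U n) <=
    C * dt * (ip L (U n) (U n) + ip L (U n.+1) (U n.+1)).
Proof.
move=> L0 dt0 C0 hC [S_0 S_lin] Sreg [SU scheme] n nN.
have SV : S (tmid U n).
  (* This shape fits the closure of [S] under [a f + g], applied twice starting from 0. *)
  have -> : tmid U n = fun x => 2^-1 * U n x + (2^-1 * U n.+1 x + (fun=> 0 : R) x).
    by apply/funext => x; rewrite /tmid; field.
  apply: (S_lin); first by apply: SU; exact: ltnW.
  by apply: S_lin => //; exact: SU.
have [cdV pV] := Sreg _ SV.
have [/cont_diff_continuous c0 _] := Sreg _ (SU n (ltnW nN)).
have [/cont_diff_continuous c1 _] := Sreg _ (SU n.+1 nN).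
have mI : measurable (`]- L, L[ : set (measurableTypeR R)) by exact: measurable_itv.
have i0 := continuous_integrable_oo _ (- L) L (continuous_sqr _ c0).
have i1 := continuous_integrable_oo _ (- L) L (continuous_sqr _ c1).
have ipE (f : R -> R) : ip L f f = \int[mu]_(x in `]- L, L[) (f x ^+ 2).
  by apply: eq_Rintegral => x _; rewrite expr2.
(* Difference times sum: the integrand is a difference of squares. *)
have quotE : ip L (tquot dt U n) (tmid U n) =
    (2 * dt)^-1 * (ip L (U n.+1) (U n.+1) - ip L (U n) (U n)).
  rewrite !ipE -(RintegralB mI i1 i0).
  rewrite -(RintegralZl _ mI (integrableB mI i1 i0)).
  apply: eq_Rintegral => x _; rewrite /tquot /tmid; field; lra.
have midle : ip L (tmid U n) (tmid U n) <=
    2^-1 * (ip L (U n) (U n) + ip L (U n.+1) (U n.+1)).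
  rewrite !ipE -(RintegralD mI i0 i1) -(RintegralZl _ mI (integrableD mI i0 i1)).
  apply: (le_Rintegral mI).
  - apply: continuous_integrable_oo; apply: continuous_sqr.
    exact: cont_diff_continuous.
  - exact: (integrableZl mI _ (integrableD mI i0 i1)).
  - by move=> x _; rewrite /tmid; have := sqr_ge0 (U n x - U n.+1 x); nra.
have := scheme n nN _ SV; rewrite /= quotE ip_mul_deriv_eq0// addr0.
have := hC _ cdV pV.
move: midle; set m := ip L (tmid U n) _; set a := ip L (U n) _.
set b := ip L (U n.+1) _; set j := ip L (nonlocal _ _) _.
set d := ip L (derive1 _) _.
move=> hm hj he.
(* The dissipation [d] in the scheme cancels the one allowed by [hj]. *)
have : (2 * dt)^-1 * (b - a) <= C * (2^-1 * (a + b)).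
  apply: (@le_trans _ _ (C * m)); last by rewrite ler_wpM2l.
  by lra.
rewrite ler_pdivrMl; last by lra.
by move/le_trans; apply; rewrite le_eqVlt; apply/orP; left; apply/eqP; field.
Qed.

(** The hypothesis reads [(1 - z) e_{n+1} <= (1 + z) e_n]. For [z <= 1/2] the growth factor is at
    most [1 + 4 z], hence at most [exp (4 z)]. *)
Lemma discrete_gronwall (e : nat -> R) (z : R) (N : nat) :
  0 <= z <= 2^-1 -> (forall n, 0 <= e n) ->
  (forall n, (n < N)%N -> e n.+1 - e n <= z * (e n + e n.+1)) ->
  forall n, (n <= N)%N -> e n <= expR (4 * z * n%:R) * e 0%N.
Proof.
move=> /andP[z0 z2] e0 he; elim=> [_|n IH nN].
  by rewrite mulr0 expR0 mul1r.
have step : e n.+1 <= (1 + 4 * z) * e n.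
  have := he n nN; have := e0 n; have := e0 n.+1 => h1 h2 h3.
  have : (1 - z) * e n.+1 <= (1 - z) * ((1 + 4 * z) * e n).
    (* Because [(1 - z) (1 + 4 z) = 1 + z + 2 z (1 - 2 z)]. *)
    have : 0 <= z * (1 - 2 * z) * e n by rewrite !mulr_ge0//; lra.
    by lra.
  by rewrite ler_pM2l//; lra.
apply: (le_trans step); rewrite -[n.+1%:R]natr1 mulrDr mulr1 expRD.
rewrite (mulrC (expR _)) -[leRHS]mulrA.
apply: ler_pM => //; first by lra.
  exact: expR_ge1Dx.
exact/IH/ltnW.
Qed.

End Energy.

(** * Choice of the constants and the stability bound *)

Theorem proposition4p4 (R : realType) (r : nat) (hr : (2 <= r)%N) :
  exists m : nat,
  forall (L : R) (hL : 0 < L)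
    (I : Type) (p : I -> seq R) (S : I -> set (R -> R))
    (hS : fe_family L r p S) (C0 : R),
  exists C1 C2 : (R -> R) -> R,
    (forall u0, regular_data L m u0 -> 0 < C1 u0 /\ 0 < C2 u0) /\
    forall T : R, 0 < T ->
    exists2 K : R, 0 < K &
      forall (u0 : R -> R) (i : I) (N : nat) (U : nat -> R -> R),
        let h := mesh L (p i) in
        let dt := T / N%:R in
        regular_data L m u0 ->
        (0 < N)%N ->
        C1 u0 * (dt / h ^+ 2) + C2 u0 * (dt / h `^ (4 / 3)) <= 1 ->
        l2norm L (U 0%N - u0) <= C0 * h ^+ r.-1 ->
        cn_scheme L (S i) dt N U ->
        forall n : nat, n%:R <= T / dt ->
          l2norm L (U n) <= K * l2norm L (U 0%N).
Proof.
exists 0%N => L L0 I p S [hS _ _] C0.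
have [C C_ge0 hC] := ip_nonlocal_le L L0.
have L20 : 0 < L ^+ 2 by rewrite exprn_gt0.
have C1_gt0 : 0 < 8 * C * L ^+ 2 + 1.
  by rewrite ltr_wpDl// mulr_ge0// ?mulr_ge0// ltW.
(* The [+ 1] keeps the first constant positive when [C = 0]. *)
exists (fun=> 8 * C * L ^+ 2 + 1), (fun=> 1); split => // T T0.
exists (Num.sqrt (expR (4 * (C * T)))); first by rewrite sqrtr_gt0 expR_gt0.
move=> u0 i N U h dt _ N0 cfl _ scheme n nT.
have N0' : 0 < N%:R :> R by rewrite ltr0n.
have dt0 : 0 < dt by rewrite divr_gt0.
have TdtN : T / dt = N%:R by rewrite /dt; field; rewrite !gt_eqF.
have nN : (n <= N)%N by rewrite -(ler_nat R) -TdtN.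
have [part lin _ _ reg] := hS i.
have /andP[h0 hL] := mesh_gt0_le L (p i) L0 part.
rewrite -/h in h0 hL.
have Cdt : C * dt <= 2^-1.
  have h2 : 0 < h ^+ 2 by rewrite exprn_gt0.
  have hle : h ^+ 2 <= 4 * L ^+ 2 by nra.
  (* Both terms of the mesh condition are nonnegative, so the first alone is at most 1. *)
  have cfl' : (8 * C * L ^+ 2 + 1) * dt <= h ^+ 2.
    rewrite -[leRHS]mul1r -ler_pdivrMr// -[leLHS]mulrA; apply: le_trans cfl.
    by rewrite /= lerDl mul1r divr_ge0// ?powR_ge0// ltW.
  have h3 : 8 * C * L ^+ 2 * dt <= 4 * L ^+ 2.
    by lra.
  rewrite -(ler_pM2r (_ : 0 < 8 * L ^+ 2)); last by rewrite mulr_gt0.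
  by lra.
have Sreg v : S i v -> cont_diff v /\ periodic v (2 * L) by move=> /reg[].
have ip_ge0 f : 0 <= ip L f f.
  by apply: Rintegral_ge0 => x _; rewrite -expr2 sqr_ge0.
have gron : ip L (U n) (U n) <= expR (4 * (C * dt) * n%:R) * ip L (U 0%N) (U 0%N).
  apply: (discrete_gronwall (fun k => ip L (U k) (U k)) _ N) nN => [|k|].
  - by rewrite Cdt mulr_ge0// ltW.
  - exact: ip_ge0.
  - exact: (crank_nicolson_energy L C dt (S i) N U L0 dt0 C_ge0 hC lin Sreg scheme).
rewrite /l2norm -sqrtrM ?expR_ge0// ler_sqrt ?mulr_ge0 ?expR_ge0//.
apply: (le_trans gron); rewrite ler_wpM2r// ler_expR -!mulrA ler_pM2l// ler_wpM2l//.
(* What remains is [n dt <= T], that is, [n / N <= 1]. *)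
by rewrite -[leRHS]mulr1 ler_pM2l// mulrC ler_pdivrMr// mul1r ler_nat.
Qed.
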